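(* Let $\Sigma$ be a finite alphabet, let $L\subseteq\Sigma^*$ be an RID language and let $\Gamma$ be an RID monadic rewriting system over $\Sigma$. Then $L\Gamma^{-1}$ is RID. Moreover, there is an algorithm which, given an RID language $L$ (encoded as an RID algorithm) and an RID monadic rewriting system $\Gamma$ (encoded via RID algorithms for the languages $\Gamma_x$, $x\in\Sigma\cup\{\varepsilon\}$), outputs an RID algorithm for $L\Gamma^{-1}$.
   Context: The regular intersection decision (RID) problem for a language $L\subseteq\Sigma^*$ is the problem of deciding, given a finite automaton over $\Sigma$, whether the language it recognises has non-empty intersection with $L$. An algorithm solving it is an RID algorithm for $L$; $L$ is RID if an RID algorithm for $L$ exists. A monadic rewriting system $\Gamma$ over a finite alphabet $\Sigma$ is a (possibly infinite) subset of $\Sigma^*\times(\Sigma\cup\{\varepsilon\})$, where $\varepsilon$ is the empty word; an element $(w,x)\in\Gamma$ is written $w\rightarrow x$. For $x\in\Sigma\cup\{\varepsilon\}$ put $\Gamma_x=\{w\in\Sigma^*\mid (w\rightarrow x)\in\Gamma\}$. $\Gamma$ is an RID monadic rewriting system if every $\Gamma_x$ is an RID language. Write $u\Rightarrow v$ if $u=rws$ and $v=rxs$ with $r,s\in\Sigma^*$ and $w\rightarrow x\in\Gamma$, and let $\Rightarrow^{*}$ be the reflexive, transitive closure of $\Rightarrow$. If $u\Rightarrow^{*}v$ then $u$ is an ancestor of $v$ and $v$ a descendant of $u$. $L\Gamma^{-1}$ denotes the set of all ancestors of elements of $L$ under $\Gamma$. *)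

(* Defs.v *)
From mathcomp Require Import all_boot.
From Stdlib Require Import Relation_Operators.

Set Implicit Arguments.
Unset Strict Implicit.
Unset Printing Implicit Defensive.

(* Algorithms are closed terms of the weak call-by-value lambda-calculus L of
   Forster and Smolka ("Weak call-by-value lambda calculus as a model of
   computation in Coq", ITP 2017), a Turing-complete model; inputs and outputs
   are Scott-encoded.  Terms use de Bruijn indices. *)
Inductive term : Type :=
| Var of nat
| App of term & term
| Lam of term.

(* No shifting of u: evaluation only ever substitutes closed terms. *)
Fixpoint subst (s : term) (k : nat) (u : term) : term :=
  match s with
  | Var n => if n == k then u else Var n
  | App s1 s2 => App (subst s1 k u) (subst s2 k u)
  | Lam s1 => Lam (subst s1 k.+1 u)
  end.

Fixpoint bound (k : nat) (s : term) : bool :=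
  match s with
  | Var n => n < k
  | App s1 s2 => bound k s1 && bound k s2
  | Lam s1 => bound k.+1 s1
  end.

Definition closed_term (s : term) : bool := bound 0 s.

(* eval s v: the computation of s halts with result v. *)
Inductive eval : term -> term -> Prop :=
| eval_lam s : eval (Lam s) (Lam s)
| eval_app s t s' t' v :
    eval s (Lam s') -> eval t t' -> eval (subst s' 0 t') v ->
    eval (App s t) v.

Definition enc_bool (b : bool) : term :=
  if b then Lam (Lam (Var 1)) else Lam (Lam (Var 0)).

Fixpoint enc_nat (n : nat) : term :=
  match n with
  | 0 => Lam (Lam (Var 1))
  | m.+1 => Lam (Lam (App (Var 0) (enc_nat m)))
  end.

Definition enc_pair (a b : term) : term :=
  Lam (App (App (Var 0) a) b).

Fixpoint enc_list (l : seq term) : term :=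
  match l with
  | [::] => Lam (Lam (Var 1))
  | a :: l' => Lam (Lam (App (App (Var 0) a) (enc_list l')))
  end.

(* The quotation of a program as a datum, with one case per constructor. *)
Fixpoint enc_term (s : term) : term :=
  match s with
  | Var n => Lam (Lam (Lam (App (Var 2) (enc_nat n))))
  | App s1 s2 => Lam (Lam (Lam (App (App (Var 1) (enc_term s1)) (enc_term s2))))
  | Lam s1 => Lam (Lam (Lam (App (Var 0) (enc_term s1))))
  end.

Definition language (Sigma : finType) : Type := seq Sigma -> Prop.

(* An element of Sigma + {epsilon} is an option Sigma, None being epsilon. *)
Definition word_of (Sigma : finType) (x : option Sigma) : seq Sigma :=
  if x is Some a then [:: a] else [::].

(* Nondeterministic finite automata with epsilon-transitions. *)
Record automaton (Sigma : finType) : Type := Automaton {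
  nstates : nat;
  start : 'I_nstates;
  finals : seq 'I_nstates;
  trans : seq ('I_nstates * option Sigma * 'I_nstates)
}.

Inductive run (Sigma : finType) (A : automaton Sigma) :
    'I_(nstates A) -> seq Sigma -> 'I_(nstates A) -> Prop :=
| run_nil p : run p [::] p
| run_step p x q w r :
    (p, x, q) \in trans A -> run q w r -> run p (word_of x ++ w) r.

Definition recognised (Sigma : finType) (A : automaton Sigma) : language Sigma :=
  fun w => exists2 f, f \in finals A & run (start A) w f.

(* States are encoded by their numbers, and a label by its position in the
   enumeration of option Sigma. *)
Definition enc_automaton (Sigma : finType) (A : automaton Sigma) : term :=
  enc_pair (enc_nat (nstates A))
    (enc_pair (enc_nat (start A))
      (enc_pair (enc_list [seq enc_nat (nat_of_ord f) | f <- finals A])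
        (enc_list [seq enc_pair (enc_nat (nat_of_ord t.1.1))
                         (enc_pair (enc_nat (nat_of_ord (enum_rank t.1.2)))
                                   (enc_nat (nat_of_ord t.2)))
                  | t <- trans A]))).

Definition meets (Sigma : finType) (K L : language Sigma) : Prop :=
  exists w, K w /\ L w.

Definition RID_algorithm (Sigma : finType) (p : term) (L : language Sigma) : Prop :=
  closed_term p /\
  forall A : automaton Sigma, exists b : bool,
    eval (App p (enc_automaton A)) (enc_bool b) /\
    (b <-> meets (recognised A) L).

Definition RID (Sigma : finType) (L : language Sigma) : Prop :=
  exists p, RID_algorithm p L.

Definition monadic_system (Sigma : finType) : Type :=
  seq Sigma * option Sigma -> Prop.

Definition lhs (Sigma : finType) (G : monadic_system Sigma) (x : option Sigma) :
    language Sigma :=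
  fun w => G (w, x).

Definition RID_system (Sigma : finType) (G : monadic_system Sigma) : Prop :=
  forall x, RID (lhs G x).

Inductive rewrites (Sigma : finType) (G : monadic_system Sigma) :
    seq Sigma -> seq Sigma -> Prop :=
| rewrites_intro r w x s :
    G (w, x) -> rewrites G (r ++ w ++ s) (r ++ word_of x ++ s).

Definition rewrites_star (Sigma : finType) (G : monadic_system Sigma) :
    seq Sigma -> seq Sigma -> Prop :=
  clos_refl_trans (seq Sigma) (rewrites G).

Definition ancestors (Sigma : finType) (L : language Sigma)
    (G : monadic_system Sigma) : language Sigma :=
  fun u => exists v, L v /\ rewrites_star G u v.

Definition RID_system_algorithms (Sigma : finType) (P : option Sigma -> term)
    (G : monadic_system Sigma) : Prop :=
  forall x, RID_algorithm (P x) (lhs G x).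

(* The quotation of P x occurs at the position that encodes the label x. *)
Definition enc_family (Sigma : finType) (P : option Sigma -> term) : term :=
  enc_list [seq enc_term (P x) | x <- enum {: option Sigma}].

(* Main.v *)
(* Saturate a given automaton A: whenever the words leading from a state p to a
   state q meet lhs G x, add a transition from p to q labelled x.  The states are
   kept, so there are finitely many possible transitions, and as many rounds
   through all of them suffice, since a round that adds nothing new leaves the
   automaton saturated.  The result recognises the descendants of the words of
   A, hence meets L if and only if A meets the set of ancestors of L.  This
   procedure is written as a lambda-term, and the transformer of programs only
   has to quote its application to the given programs. *)

Require Import Defs.
From mathcomp Require Import all_boot.
From Stdlib Require Import Relation_Operators.

Set Implicit Arguments.
Unset Strict Implicit.
Unset Printing Implicit Defensive.

(** * Call-by-value reduction and closed values *)

Variant reduces (s t : term) : Prop :=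
| Reduces of (forall v, eval t v -> eval s v).

Lemma reduces_refl s : reduces s s.
Proof. by split. Qed.

Lemma reduces_trans t s u : reduces s t -> reduces t u -> reduces s u.
Proof. by case=> st [tu]; split=> v /tu /st. Qed.

(** Since [reduces] compares final results rather than single steps, congruence holds on both sides
    of an application, whatever the order of evaluation. *)
Lemma reduces_appl s s' t : reduces s s' -> reduces (App s t) (App s' t).
Proof.
case=> ss'; split=> v ev; inversion ev; subst.
by apply: eval_app; eauto.
Qed.

Lemma reduces_appr s t t' : reduces t t' -> reduces (App s t) (App s t').
Proof.
case=> tt'; split=> v ev; inversion ev; subst.
by apply: eval_app; eauto.
Qed.

Definition value (s : term) : bool := if s is Lam _ then true else false.

Lemma eval_value s : value s -> eval s s.
Proof. by case: s => // s _; apply: eval_lam. Qed.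

Lemma reduces_beta s t : value t -> reduces (App (Lam s) t) (subst s 0 t).
Proof.
move=> vt; split=> v ev; apply: eval_app ev; first exact: eval_lam.
exact: eval_value.
Qed.

Lemma reduces_eval s t : value t -> reduces s t -> eval s t.
Proof. by move=> vt [st]; apply: st; apply: eval_value. Qed.

Lemma eval_reduces s t : value t -> eval s t -> reduces s t.
Proof. by case: t => // t _ st; split=> v ev; inversion ev; subst. Qed.

Lemma bound_leq k j s : bound k s -> k <= j -> bound j s.
Proof.
elim: s k j => [n|s IHs t IHt|s IHs] k j /=.
- exact: leq_trans.
- by case/andP=> bs bt kj; apply/andP; split; [apply: IHs kj | apply: IHt kj].
- by move=> bs kj; apply: (IHs k.+1).
Qed.

Lemma closed_bound k s : closed_term s -> bound k s.
Proof. by move/bound_leq; apply. Qed.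

Lemma subst_bound k s u : bound k s -> subst s k u = s.
Proof.
elim: s k => [n|s IHs t IHt|s IHs] k /=.
- by rewrite ltn_neqAle; case: eqP.
- by case/andP=> bs bt; rewrite IHs ?IHt.
- by move=> bs; rewrite IHs.
Qed.

Lemma subst_closed s k u : closed_term s -> subst s k u = s.
Proof. by move/(closed_bound k); apply: subst_bound. Qed.

Definition procedure (s : term) : bool := value s && closed_term s.

Lemma procedure_value s : procedure s -> value s.
Proof. by case/andP. Qed.

Lemma procedure_closed s : procedure s -> closed_term s.
Proof. by case/andP. Qed.

Lemma procedure_enc_nat n : procedure (enc_nat n).
Proof.
elim: n => // n IHn; rewrite /procedure /closed_term /=.
by rewrite closed_bound // procedure_closed.
Qed.

Lemma procedure_enc_pair s t :
  closed_term s -> closed_term t -> procedure (enc_pair s t).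
Proof. by move=> cs ct; rewrite /procedure /closed_term /= !closed_bound. Qed.

Lemma procedure_enc_list l : all closed_term l -> procedure (enc_list l).
Proof.
elim: l => //= s l IHl /andP[cs cl]; rewrite /procedure /closed_term /=.
by rewrite !closed_bound // procedure_closed // IHl.
Qed.

Lemma procedure_enc_term s : procedure (enc_term s).
Proof.
elim: s => [n|s IHs t IHt|s IHs]; rewrite /procedure /closed_term /=.
- by rewrite closed_bound // procedure_closed // procedure_enc_nat.
- by rewrite !closed_bound // procedure_closed.
- by rewrite closed_bound // procedure_closed.
Qed.

Lemma procedure_enc_map (X : Type) (e : X -> term) (l : seq X) :
  (forall x, procedure (e x)) -> procedure (enc_list (map e l)).
Proof.
move=> pe; apply: procedure_enc_list.
by elim: l => //= x l ->; rewrite procedure_closed.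
Qed.

(** Turns a closed program into a value with the same behaviour on values, so that it can be
    substituted without being run. *)
Definition eta (s : term) : term := Lam (App s (Var 0)).

Lemma procedure_eta s : closed_term s -> procedure (eta s).
Proof. by move=> cs; rewrite /procedure /closed_term /= closed_bound. Qed.

Lemma reduces_eta s v :
  closed_term s -> value v -> reduces (App (eta s) v) (App s v).
Proof.
move=> cs vv; apply: (reduces_trans (reduces_beta _ vv)) => /=.
by rewrite subst_closed.
Qed.

Create HintDb procs.
#[local] Hint Resolve procedure_value procedure_closed
  procedure_enc_nat procedure_enc_pair procedure_enc_list procedure_enc_term
  procedure_enc_map procedure_eta : procs.

Ltac simpl_subst :=
  simpl;
  repeat match goal with
  | |- context [subst ?s ?k ?u] =>
      rewrite (@subst_closed s k u); [|solve [auto with procs]]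
  end.

Ltac reduce_with tac :=
  lazymatch goal with
  | |- reduces (App _ _) _ =>
    first [ tac
          | apply: reduces_appl; reduce_with tac
          | apply: reduces_appr; reduce_with tac ]
  end.

Ltac solve_value := solve [exact isT | auto with procs].

Ltac beta_redex :=
  idtac;
  lazymatch goal with
  | |- reduces (App (Lam _) _) _ => apply: reduces_beta; solve_value
  end.

Ltac beta_once :=
  eapply reduces_trans; [ reduce_with beta_redex | simpl_subst ].

Ltac reduce H :=
  eapply reduces_trans; [reduce_with ltac:(apply: H; solve_value) |].

(** * Relational folds and the loops that realise them *)

Fixpoint folds (X B : Type) (S : X -> B -> B -> Prop) (l : seq X) (a a' : B) :
    Prop :=
  if l is x :: l' then exists2 b, S x a b & folds S l' b a' else a = a'.

Lemma folds_cat (X B : Type) (S : X -> B -> B -> Prop) l1 l2 a b c :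
  folds S l1 a b -> folds S l2 b c -> folds S (l1 ++ l2) a c.
Proof.
elim: l1 a => [|x l1 IHl] a /=; first by move=> ->.
by case=> d ad db bc; exists d => //; apply: IHl.
Qed.

Lemma folds_sub (X B : Type) (S S' : X -> B -> B -> Prop) l a b :
  (forall x a b, S x a b -> S' x a b) -> folds S l a b -> folds S' l a b.
Proof.
by move=> SS'; elim: l a => //= x l IHl a [c /SS' ac /IHl cb]; exists c.
Qed.

Lemma folds_inv (X B : Type) (I : B -> Prop) (S : X -> B -> B -> Prop) l a b :
  (forall x a b, I a -> S x a b -> I b) -> folds S l a b -> I a -> I b.
Proof.
move=> IS; elim: l a => [|x l IHl] a /=; first by move=> ->.
by case=> c ac cb Ia; apply: IHl cb _; apply: IS ac.
Qed.

Lemma folds_map (X Y B : Type) (S : Y -> B -> B -> Prop) (h : X -> Y) l a b :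
  folds (fun x => S (h x)) l a b -> folds S (map h l) a b.
Proof. by elim: l a => //= x l IHl a [c ac /IHl cb]; exists c. Qed.

Lemma folds_flatten (X Y B : Type) (S : Y -> B -> B -> Prop) (h : X -> seq Y)
    l a b :
  folds (fun x => folds S (h x)) l a b -> folds S (flatten (map h l)) a b.
Proof.
elim: l a => //= x l IHl a [c ac /IHl cb]; exact: folds_cat ac cb.
Qed.

(** Loop specifications are existential, because the accumulator depends on answers of given
    programs that are only known to exist. This allows reducing before the witness is chosen. *)
Lemma ex_reduces (B : Type) (Q : B -> Prop) (enc : B -> term) s t :
  reduces s t -> (exists2 b, Q b & reduces t (enc b)) ->
  exists2 b, Q b & reduces s (enc b).
Proof. by move=> st [b Qb tb]; exists b => //; apply: reduces_trans tb. Qed.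

(* loop f n a = match n with 0 => a | m.+1 => loop f m (f m a) end. *)
Definition nat_loop_body : term :=
  Lam (Lam (Lam (Lam (App (App (Var 1) (Var 0))
    (Lam (App (App (App (App (Var 4) (Var 4)) (Var 3)) (Var 0))
              (App (App (Var 3) (Var 0)) (Var 1)))))))).

Definition nat_loop (f n a : term) : term :=
  App (App (App (App nat_loop_body nat_loop_body) f) n) a.

(** The body receives the predecessor of the counter, so the labels come in the order n-1, ...,
    0. *)
Lemma nat_loop_spec (X B : Type) (lab : X -> nat) (enc : B -> term)
    (S : X -> B -> B -> Prop) (f : term) :
  (forall b, procedure (enc b)) -> procedure f ->
  (forall x a, exists2 a', S x a a' &
     reduces (App (App f (enc_nat (lab x))) (enc a)) (enc a')) ->
  forall n l a, map lab l = rev (iota 0 n) ->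
  exists2 a', folds S l a a' &
    reduces (nat_loop f (enc_nat n) (enc a)) (enc a').
Proof.
move=> pe pf Hf; elim=> [|n IHn] l a.
  case: l => //= _; exists a => //; rewrite /nat_loop /nat_loop_body.
  do 6! beta_once; exact: reduces_refl.
have -> : rev (iota 0 n.+1) = n :: rev (iota 0 n).
  by rewrite -addn1 iotaD rev_cat.
case: l => //= x l [Ex El].
have [b Sb rb] := Hf x a; have [c Sc rc] := IHn l b El.
exists c; first by exists b.
rewrite Ex in rb.
by rewrite /nat_loop {1}/nat_loop_body; do 7! beta_once; reduce rb.
Qed.

(* loop f i l a =
     match l with [::] => a | h :: t => loop f i.+1 t (f i h a) end. *)
Definition list_loop_body : term :=
  Lam (Lam (Lam (Lam (Lam (App (App (Var 1) (Var 0))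
    (Lam (Lam
      (App (App (App (App (App (Var 6) (Var 6)) (Var 5))
                     (Lam (Lam (App (Var 0) (Var 6))))) (Var 0))
           (App (App (App (Var 5) (Var 4)) (Var 1)) (Var 2)))))))))).

Definition list_loop (f i l a : term) : term :=
  App (App (App (App (App list_loop_body list_loop_body) f) i) l) a.

Lemma list_loop_spec (X B : Type) (lab : X -> nat) (item : X -> term)
    (enc : B -> term) (S : X -> B -> B -> Prop) (f : term) :
  (forall x, procedure (item x)) -> (forall b, procedure (enc b)) ->
  procedure f ->
  (forall x a, exists2 a', S x a a' &
     reduces (App (App (App f (enc_nat (lab x))) (item x)) (enc a)) (enc a')) ->
  forall l i a, map lab l = iota i (size l) ->
  exists2 a', folds S l a a' &
    reduces (list_loop f (enc_nat i) (enc_list (map item l)) (enc a)) (enc a').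
Proof.
move=> pit pe pf Hf; elim=> [|x l IHl] i a.
  move=> _; exists a => //; rewrite /list_loop /list_loop_body.
  by do 7! beta_once; apply: reduces_refl.
case=> Ex El; have [b Sb rb] := Hf x a; have [c Sc rc] := IHl i.+1 b El.
exists c; first by exists b.
rewrite Ex in rb.
by rewrite /list_loop {1}/list_loop_body; do 9! beta_once; reduce rb.
Qed.

Definition triples (X Y Z : Type) (ps : seq X) (qs : seq Y) (xs : seq Z) :
    seq (X * Z * Y) :=
  flatten [seq flatten [seq [seq (p, x, q) | x <- xs] | q <- qs] | p <- ps].

Lemma folds_triples (X Y Z B : Type) (S : X * Z * Y -> B -> B -> Prop)
    ps qs xs a b :
  folds (fun p => folds (fun q => folds (fun x => S (p, x, q)) xs) qs) ps a b ->
  folds S (triples ps qs xs) a b.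
Proof.
move=> Sab; apply: folds_flatten; apply: folds_sub Sab => p {}a {}b Sab.
apply: folds_flatten; apply: folds_sub Sab => q {}a {}b.
exact: folds_map.
Qed.

(** The order in which [triple_loop] visits the transitions: states are reversed because [nat_loop]
    counts down, labels are not because [list_loop] counts up. *)
Definition all_triples (n : nat) (X : finType) : seq ('I_n * X * 'I_n) :=
  triples (rev (enum 'I_n)) (rev (enum 'I_n)) (enum X).

Lemma mem_all_triples n (X : finType) (t : 'I_n * X * 'I_n) :
  t \in all_triples n X.
Proof.
case: t => [[p x] q]; apply/flatten_mapP; exists p.
  by rewrite mem_rev mem_enum.
apply/flatten_mapP; exists q; first by rewrite mem_rev mem_enum.
by apply/mapP; exists x; rewrite ?mem_enum.
Qed.

Lemma map_enum_rank (T : finType) :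
  [seq (enum_rank x : nat) | x <- enum T] = iota 0 (size (enum T)).
Proof.
apply: (@eq_from_nth _ 0); rewrite size_map ?size_iota // => i lti.
(* [nth] needs a default; the index [i] witnesses that [T] is inhabited. *)
have x0 : T by case: (enum T) lti.
rewrite (nth_map x0) // nth_iota // add0n.
have lti' : i < #|T| by rewrite cardE.
rewrite -[i in nth x0 _ i]/(nat_of_ord (Ordinal lti')).
by rewrite -(enum_val_nth (A := T) x0 (Ordinal lti')) enum_valK.
Qed.

(* fun n Ps g a =>
     nat_loop (fun p => nat_loop (fun q =>
       list_loop (fun i P a => g p q i P a) 0 Ps) n) n a *)
Definition triple_loop : term :=
  Lam (Lam (Lam (Lam
    (nat_loop
       (Lam (Lam (nat_loop
          (Lam (Lam (list_loop
             (Lam (Lam (Lam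
                (App (App (App (App (App (Var 8) (Var 6)) (Var 4)) (Var 2))
                          (Var 1)) (Var 0)))))
             (enc_nat 0) (Var 6) (Var 0))))
          (Var 5) (Var 0))))
       (Var 3) (Var 0))))).

Lemma triple_loop_spec (n : nat) (X : finType) (item : X -> term) (B : Type)
    (enc : B -> term) (S : 'I_n * X * 'I_n -> B -> B -> Prop) (f : term) :
  (forall x, procedure (item x)) -> (forall b, procedure (enc b)) ->
  procedure f ->
  (forall (p : 'I_n) x (q : 'I_n) a, exists2 a', S (p, x, q) a a' &
     reduces (App (App (App (App (App f (enc_nat p)) (enc_nat q))
                        (enc_nat (enum_rank x))) (item x)) (enc a)) (enc a')) ->
  forall a, exists2 a', folds S (all_triples n X) a a' &
    reduces (App (App (App (App triple_loop (enc_nat n))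
                        (enc_list (map item (enum X)))) f)
                 (enc a)) (enc a').
Proof.
move=> pit pe pf Hf a.
have r0 : [seq (nat_of_ord i) | i <- rev (enum 'I_n)] = rev (iota 0 n).
  by rewrite map_rev val_enum_ord.
(* The loop body is [triple_loop]'s own, with the number of states, the list and [f] substituted. *)
have [||a' Sa ra] := nat_loop_spec (X := 'I_n) (lab := @nat_of_ord n)
  (enc := enc)
  (S := fun p => folds (fun q => folds (fun x => S (p, x, q)) (enum X))
                       (rev (enum 'I_n)))
  pe (f := Lam (Lam (nat_loop
          (Lam (Lam (list_loop
             (Lam (Lam (Lam
                (App (App (App (App (App f (Var 6)) (Var 4)) (Var 2))
                          (Var 1)) (Var 0)))))
             (enc_nat 0) (enc_list (map item (enum X))) (Var 0))))
          (enc_nat n) (Var 0)))) _ _ a r0.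
- by rewrite /procedure /closed_term /= !closed_bound; auto with procs.
- move=> p b.
  apply: ex_reduces; first by do 2! beta_once; apply: reduces_refl.
  apply: nat_loop_spec r0 => //.
    by rewrite /procedure /closed_term /= !closed_bound; auto with procs.
  move=> q c.
  apply: ex_reduces; first by do 2! beta_once; apply: reduces_refl.
  apply: (list_loop_spec (S := fun x => S (p, x, q))
    (lab := fun x => enum_rank x) _ _ _ _ (i := 0)) => //.
  - by rewrite /procedure /closed_term /= !closed_bound; auto with procs.
  - move=> x d.
    by apply: ex_reduces; first by do 3! beta_once; apply: reduces_refl.
  - exact: map_enum_rank.
- exists a'; last by rewrite /triple_loop; do 4! beta_once.
  exact: folds_triples.
Qed.

(** * Runs of automata and contexts of rewriting *)

Lemma run_cat (Sigma : finType) (A : automaton Sigma) p u q v r :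
  @run Sigma A p u q -> run q v r -> run p (u ++ v) r.
Proof.
elim=> // {}p x q' w {}q pxq _ IH /IH; rewrite -catA; exact: run_step.
Qed.

Lemma run_label (Sigma : finType) (A : automaton Sigma) p x q :
  (p, x, q) \in trans A -> @run Sigma A p (word_of x) q.
Proof.
by move=> pxq; rewrite -[word_of x]cats0; apply: run_step pxq (run_nil _).
Qed.

(** Induction on the run: if [u] is empty, cut at the start; otherwise a letter transition consumes
    the head of [u] and an epsilon-transition leaves [u] as it is. *)
Lemma run_catP (Sigma : finType) (A : automaton Sigma) p u v r :
  @run Sigma A p (u ++ v) r -> exists2 q, run p u q & run q v r.
Proof.
move: {2}(u ++ v) (erefl (u ++ v)) => w ew; rewrite ew => pr.
elim: pr u ew => [{}p|{}p x q {}w {}r pxq qr IH] [|a u] //= ew.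
- by exists p; [|move: ew => /= ->]; apply: run_nil.
- by exists p; [apply: run_nil | rewrite ew; apply: run_step pxq qr].
- case: x pxq ew => [b|] pxq /= ew.
    case: ew => eab /IH[s qs sr]; exists s => //.
    by rewrite eab; apply: run_step pxq qs.
  have [s qs sr] := IH (a :: u) ew.
  by exists s => //; apply: run_step pxq qs.
Qed.

Definition with_trans (Sigma : finType) (A : automaton Sigma) tr :
    automaton Sigma :=
  @Automaton Sigma (nstates A) (start A) (finals A) tr.

Arguments with_trans {Sigma} A tr.

(** Runs depend on the transitions alone, so start and final states may change freely, as they do in
    [enabled]. *)
Lemma run_sub (Sigma : finType) n (s s' : 'I_n) F F' tr tr' p u q :
  {subset tr <= tr'} ->
  @run Sigma (Automaton s F tr) p u q ->
  @run Sigma (Automaton s' F' tr') p u q.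
Proof.
move=> sub; elim=> [{}p|{}p x {}q w r pxq _]; first exact: run_nil.
exact/run_step/sub.
Qed.

Lemma rewrites_star_ctx (Sigma : finType) (G : monadic_system Sigma) r u v s :
  rewrites_star G u v -> rewrites_star G (r ++ u ++ s) (r ++ v ++ s).
Proof.
elim=> {u v} [_ _ [r' w x s' Gwx]|u|u v w _ uv _ vw].
- by apply: rt_step; rewrite -!catA !(catA r); apply: rewrites_intro.
- exact: rt_refl.
- exact: rt_trans uv vw.
Qed.

Lemma rewrites_star_cat (Sigma : finType) (G : monadic_system Sigma) u u' v v' :
  rewrites_star G u u' -> rewrites_star G v v' ->
  rewrites_star G (u ++ v) (u' ++ v').
Proof.
move=> uu' vv'; apply: (rt_trans _ _ _ (u' ++ v)).
  exact: (rewrites_star_ctx [::] v uu').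
by have := rewrites_star_ctx u' [::] vv'; rewrite !cats0.
Qed.

(** * Saturation: soundness, termination and completeness *)

Section Saturation.

Variables (Sigma : finType) (A : automaton Sigma) (G : monadic_system Sigma).

Notation transition := ('I_(nstates A) * option Sigma * 'I_(nstates A))%type.

(** Phrased as the very question that an RID algorithm for [lhs G x] answers, on the automaton with
    one end of [t] as start and the other as sole final state. *)
Definition enabled (t : transition) (tr : seq transition) : Prop :=
  meets (recognised (@Automaton Sigma (nstates A) t.1.1 [:: t.2] tr))
        (lhs G t.1.2).

(** Whether [t] is already present is not tested. Duplicates are harmless, since progress is
    measured by [#|tr|], which counts distinct transitions. *)
Definition saturation_step (t : transition) (tr tr' : seq transition) : Prop :=
  exists2 b : bool, b <-> enabled t tr & tr' = if b then t :: tr else tr.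

Definition saturation_round : seq transition -> seq transition -> Prop :=
  folds saturation_step (all_triples _ _).

Definition saturation : seq transition -> seq transition -> Prop :=
  folds (fun _ => saturation_round) (all_triples (nstates A) (option Sigma)).

Definition saturated (tr : seq transition) : Prop :=
  forall t, enabled t tr -> t \in tr.

Definition sound (tr : seq transition) : Prop :=
  forall p w q, @run Sigma (with_trans A tr) p w q ->
  exists2 u, @run Sigma A p u q & rewrites_star G u w.

Lemma enabledP p x q tr :
  enabled (p, x, q) tr <->
  exists2 v, @run Sigma (with_trans A tr) p v q & G (v, x).
Proof.
rewrite /enabled; split=> [[v [[f]]]|[v pq Gvx]].
  rewrite inE => /eqP ef pf Gvx; exists v => //; move: pf; rewrite {}ef /=.
  exact: run_sub.
exists v; split=> //; exists q; first exact: mem_head.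
exact: run_sub pq.
Qed.

Lemma enabled_sub t tr tr' :
  {subset tr <= tr'} -> enabled t tr -> enabled t tr'.
Proof.
case: t => [[p x] q] sub /enabledP[v pq Gvx]; apply/enabledP.
by exists v => //; apply: run_sub pq.
Qed.

(** The new transition is backed by a word [v] with [v] -> [x], and [v] descends from a word [u]
    read by [A] between the same states. Replacing each transition of a run by such a word of [A]
    and concatenating gives the required ancestor. *)
Lemma sound_step t tr tr' : sound tr -> saturation_step t tr tr' -> sound tr'.
Proof.
case: t => [[p x] q] snd [[] en ->] //.
have [v /snd[u pu uv] Gvx] := (enabledP p x q tr).1 (en.1 isT).
move=> p' w q'; elim=> [{}p'|{}p' y r {}w {}q' pxq _ [u' ru uw]].
  by exists [::]; [apply: run_nil | apply: rt_refl].
suff [u1 pu1 u1y] :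
    exists2 u1, @run Sigma A p' u1 r & rewrites_star G u1 (word_of y).
  exists (u1 ++ u'); first exact: run_cat pu1 ru.
  exact: rewrites_star_cat.
move: pxq; rewrite inE => /predU1P[[-> -> ->]|pxq]; last first.
  exact/snd/run_label.
exists u => //; apply: rt_trans uv _; apply: rt_step.
by have := rewrites_intro [::] [::] Gvx; rewrite !cats0.
Qed.

Lemma saturation_step_sub t tr tr' :
  saturation_step t tr tr' -> {subset tr <= tr'}.
Proof. by case=> [[] _ ->] // t' trt'; rewrite inE trt' orbT. Qed.

Lemma saturation_round_sub tr tr' :
  saturation_round tr tr' -> {subset tr <= tr'}.
Proof.
move=> Str; apply: (folds_inv (I := fun a => {subset tr <= a}) _ Str) => //.
by move=> t a b sub /saturation_step_sub ab t' /sub /ab.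
Qed.

(** Enabledness is monotone in the transitions, so [t] is still enabled when the round reaches it,
    and nothing is removed afterwards. *)
Lemma saturation_round_enabled tr tr' t :
  saturation_round tr tr' -> enabled t tr -> t \in tr'.
Proof.
rewrite /saturation_round; move: (mem_all_triples t).
elim: (all_triples _ _) tr => //= t' l IHl tr tl [a Sa al] en.
have sub := saturation_step_sub Sa.
move: tl; rewrite inE => /predU1P[ett'|tl]; last first.
  exact: IHl tl al (enabled_sub sub en).
apply: (folds_inv (I := fun c : seq transition => t \in c) _ al).
  by move=> ? c d tc /saturation_step_sub; apply.
move: Sa; rewrite -ett' => -[[] Eb ->]; first exact: mem_head.
by move/Eb.2: en.
Qed.

Lemma saturation_round_saturated tr tr' :
  saturated tr -> saturation_round tr tr' -> tr' =i tr.
Proof.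
move=> sat Str; apply: (folds_inv (I := fun a => a =i tr) _ Str) => //.
move=> t a b atr [[] en ->] // t'; rewrite inE atr.
case: eqP => // -> /=; apply/esym/sat/(enabled_sub _ (en.1 isT)).
by move=> c; rewrite atr.
Qed.

Lemma saturated_eq tr tr' : tr' =i tr -> saturated tr -> saturated tr'.
Proof.
move=> etr sat t en; rewrite etr; apply/sat/(enabled_sub _ en).
by move=> c; rewrite etr.
Qed.

(** Each round either gains a distinct transition or shows that its input was saturated, and
    saturation persists through later rounds. *)
Lemma saturation_rounds_card (X : Type) (l : seq X) tr tr' :
  folds (fun _ => saturation_round) l tr tr' ->
  saturated tr' \/ size l + #|tr| <= #|tr'|.
Proof.
elim: l tr => [|x l IHl] tr /=; first by move=> ->; right.
case=> a tra altr'; have [|le_a] := IHl _ altr'; first by left.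
have sub := saturation_round_sub tra.
have [lt_a|le_tr] := ltnP #|tr| #|a|.
  by right; apply: leq_trans le_a; rewrite addSnnS leq_add2l.
left.
(* An inclusion without growth in cardinality is an equality; hence whatever was enabled in [tr] was
   already there. *)
have atr : a =i tr.
  have /subset_leqif_card[le eqc] : tr \subset a by apply/subsetP.
  move: eqc; rewrite eqn_leq le le_tr => /esym/subsetP sub' t.
  by apply/idP/idP; [apply: sub' | apply: sub].
have sat : saturated tr.
  by move=> t en; rewrite -atr; apply: saturation_round_enabled en.
apply: (folds_inv (I := saturated) _ altr'); last exact: saturated_eq atr sat.
move=> _ c d satc cd.
exact: saturated_eq (saturation_round_saturated satc cd) satc.
Qed.

Lemma saturation_saturated tr tr' : saturation tr tr' -> saturated tr'.
Proof.
move=> /saturation_rounds_card[//|le_tr'] t _.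
(* In the remaining case the count reaches the number of all transitions, so every [t] is present,
   enabled or not. *)
suff /eqP e : #|tr'| == #|{: transition}|.
  have /subset_leqif_card[_ /esym] : tr' \subset {: transition}.
    exact/subsetP.
  rewrite e eqxx; move=> /idP/subsetP; exact.
rewrite eqn_leq max_card (leq_trans _ le_tr') //.
apply: leq_trans (leq_addr _ _); rewrite cardE uniq_leq_size ?enum_uniq //.
by move=> t' _; apply: mem_all_triples.
Qed.

Lemma saturation_sub tr tr' : saturation tr tr' -> {subset tr <= tr'}.
Proof.
move=> Str; apply: (folds_inv (I := fun a => {subset tr <= a}) _ Str) => //.
by move=> t a b sub /saturation_round_sub ab t' /sub /ab.
Qed.

Lemma saturation_sound tr tr' : saturation tr tr' -> sound tr -> sound tr'.
Proof.
apply: folds_inv => _ a b snd; move: snd => /[swap].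
by apply: folds_inv => t c d; apply: sound_step.
Qed.

(** In a run over [r ++ w ++ s], the part reading [w] enables a transition labelled [x] between its
    ends; saturation provides it as a shortcut. *)
Lemma saturated_run tr p u w q :
  saturated tr -> rewrites_star G u w ->
  @run Sigma (with_trans A tr) p u q -> @run Sigma (with_trans A tr) p w q.
Proof.
move=> sat; elim=> {u w} [_ _ [r w x s Gwx]|//|u v w _ uv _ vw]; last first.
  by move=> /uv /vw.
move=> /run_catP[p1 pr /run_catP[p2 pw ps]].
apply: (run_cat pr); apply: run_cat ps; apply/run_label/sat/enabledP.
by exists w.
Qed.

(** Soundness pulls an accepted word of [L] back to an ancestor accepted by [A]. Conversely, a run
    of [A] over an ancestor survives in the larger automaton and is carried along the rewriting by
    [saturated_run]. *)
Lemma meets_saturation (L : language Sigma) tr :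
  saturation (trans A) tr ->
  meets (recognised (with_trans A tr)) L <->
  meets (recognised A) (ancestors L G).
Proof.
move=> Str; split=> [[w [[f Ff /= pf] Lw]]|[u [[f Ff uf] [w [Lw uw]]]]].
  have snd : sound (trans A).
    move=> p v q pq; exists v; last exact: rt_refl.
    by case: (A) p q pq.
  have [u uf uw] := saturation_sound Str snd pf.
  by exists u; split; [exists f | exists w].
exists w; split=> //; exists f => //.
apply: (saturated_run (saturation_saturated Str) uw).
have := saturation_sub Str; move: {Str} tr.
by case: (A) f {Ff} uf => n s F tr f uf tr' sub; apply: run_sub uf.
Qed.

End Saturation.

(** * The saturation procedure as a lambda-term *)

Definition enc_transitions (Sigma : finType) n
    (tr : seq ('I_n * option Sigma * 'I_n)) : term :=
  enc_list [seq enc_pair (enc_nat (nat_of_ord t.1.1))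
                  (enc_pair (enc_nat (nat_of_ord (enum_rank t.1.2)))
                            (enc_nat (nat_of_ord t.2)))
           | t <- tr].

Lemma procedure_enc_transitions (Sigma : finType) n
    (tr : seq ('I_n * option Sigma * 'I_n)) :
  procedure (enc_transitions tr).
Proof. by apply: procedure_enc_map => t; auto 7 with procs. Qed.

#[local] Hint Resolve procedure_enc_transitions : procs.

Lemma procedure_enc_automaton (Sigma : finType) (A : automaton Sigma) :
  procedure (enc_automaton A).
Proof.
rewrite /enc_automaton -/(enc_transitions (trans A)).
by auto 8 with procs.
Qed.

#[local] Hint Resolve procedure_enc_automaton : procs.

(* fun p q i P tr =>
     if P (n, (p, ([:: q], tr))) then (p, (i, q)) :: tr else tr,
   where n may be a variable, numbered as under the six binders above it. *)
Definition step_code (n : term) : term :=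
  Lam (Lam (Lam (Lam (Lam
    (App (App (App (Var 1)
       (enc_pair n (enc_pair (Var 6) (enc_pair (enc_list [:: Var 8]) (Var 3)))))
       (Lam (Lam (App (App (Var 0)
          (enc_pair (Var 7) (enc_pair (Var 6) (Var 7)))) (Var 2)))))
       (Var 0)))))).

Lemma step_code_spec (Sigma : finType) (A : automaton Sigma)
    (G : monadic_system Sigma) (P : option Sigma -> term) :
  RID_system_algorithms P G ->
  forall p x q tr, exists2 tr', saturation_step (A := A) G (p, x, q) tr tr' &
    reduces (App (App (App (App (App (step_code (enc_nat (nstates A)))
       (enc_nat p)) (enc_nat q)) (enc_nat (enum_rank x))) (eta (P x)))
       (enc_transitions tr)) (enc_transitions tr').
Proof.
move=> HP p x q tr; have [cP HPx] := HP x.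
(* The automaton of [enabled], so the answer of [P x] on it decides the step. *)
pose B := @Automaton Sigma (nstates A) p [:: q] tr.
have [b [ev Eb]] := HPx B.
exists (if b then (p, x, q) :: tr else tr); first by exists b.
have rb : reduces (App (eta (P x)) (enc_automaton B)) (enc_bool b).
  apply: reduces_trans (eval_reduces _ ev); last by case: (b).
  by apply: reduces_eta => //; auto with procs.
rewrite /step_code.
do 5! beta_once.
(* The Scott boolean in head position selects between the extended and the old list, both already
   values. *)
apply: (reduces_trans (reduces_appl _ (reduces_appl _ rb))).
by case: (b); rewrite [enc_bool _]/=; do 2! beta_once; apply: reduces_refl.
Qed.

(* fun p Ps A => let (n, (s, (F, tr))) := A in
     p (n, (s, (F, triple_loop n Ps
                     (fun _ _ _ _ tr => triple_loop n Ps (step_code n) tr) tr))) *)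
Definition saturate_code : term :=
  Lam (Lam (Lam (App (Var 0) (Lam (Lam (App (Var 0) (Lam (Lam (App (Var 0)
    (Lam (Lam
      (App
        (Lam (App (Var 9) (enc_pair (Var 7) (enc_pair (Var 6)
                (enc_pair (Var 5) (Var 3))))))
        (App (App (App (App triple_loop (Var 5)) (Var 7))
          (Lam (Lam (Lam (Lam (Lam
            (App (App (App (App triple_loop (Var 10)) (Var 12))
                   (step_code (Var 16))) (Var 0))))))))
          (Var 0)))))))))))))).

Lemma saturate_code_spec (Sigma : finType) (A : automaton Sigma)
    (G : monadic_system Sigma) (P : option Sigma -> term) (p : term) :
  RID_system_algorithms P G -> procedure p ->
  exists2 tr, saturation (A := A) G (trans A) tr &
    reduces
      (App (App (App saturate_code p)
              (enc_list [seq eta (P x) | x <- enum {: option Sigma}]))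
           (enc_automaton A))
      (App p (enc_automaton (with_trans A tr))).
Proof.
move=> HP pp.
have pP x : procedure (eta (P x)) by apply: procedure_eta; case: (HP x).
(* One round; the outer loop repeats it and ignores the triple it visits. *)
pose loop a := App (App (App (App triple_loop (enc_nat (nstates A)))
   (enc_list [seq eta (P x) | x <- enum {: option Sigma}]))
   (step_code (enc_nat (nstates A)))) a.
have ps : procedure (step_code (enc_nat (nstates A))).
  by rewrite /procedure /closed_term /= !closed_bound; auto with procs.
have [||t x q a|tr Str rtr] := @triple_loop_spec (nstates A) _
  (fun x => eta (P x)) _ (@enc_transitions Sigma (nstates A))
  (fun _ => saturation_round G)
  (Lam (Lam (Lam (Lam (Lam (loop (Var 0))))))) pP _ _ _ (trans A).
- by auto with procs.
- by rewrite /procedure /closed_term /= !closed_bound; auto with procs.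
- apply: ex_reduces; first by do 5! beta_once; apply: reduces_refl.
  apply: triple_loop_spec => //; first by auto with procs.
  exact: step_code_spec.
- exists tr => //.
  rewrite /enc_automaton -!/(enc_transitions _) /enc_pair /saturate_code.
  do 12! beta_once.
  (* The saturated list is computed as the argument of a redex: written directly inside the encoded
     pair, it would sit under a binder and never be evaluated. *)
  by reduce rtr; beta_once; apply: reduces_refl.
Qed.

(** * Computing quotations of programs *)

Definition quote_app : term :=
  Lam (Lam (Lam (Lam (Lam (App (App (Var 1) (Var 4)) (Var 3)))))).

Definition quote_lam : term := Lam (Lam (Lam (Lam (App (Var 0) (Var 3))))).

Definition quote_eta (s : term) : term :=
  App quote_lam (App (App quote_app s) (enc_term (Var 0))).

Lemma quote_app_spec a b s t :
  reduces a (enc_term s) -> reduces b (enc_term t) ->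
  reduces (App (App quote_app a) b) (enc_term (App s t)).
Proof.
move=> ra rb; apply: reduces_trans (reduces_appr _ rb) _.
apply: reduces_trans (reduces_appl _ (reduces_appr _ ra)) _.
by rewrite /quote_app; do 2! beta_once; apply: reduces_refl.
Qed.

Lemma quote_lam_spec a s :
  reduces a (enc_term s) -> reduces (App quote_lam a) (enc_term (Lam s)).
Proof.
move=> ra; apply: reduces_trans (reduces_appr _ ra) _.
by rewrite /quote_lam; beta_once; apply: reduces_refl.
Qed.

Lemma quote_eta_spec s : reduces (quote_eta (enc_term s)) (enc_term (eta s)).
Proof.
by apply: quote_lam_spec; apply: quote_app_spec; apply: reduces_refl.
Qed.

(** From an encoded list of quotations to the quotation of an encoded list: each item rebuilds, one
    level up, the Scott cons [Lam (Lam (App (App (Var 0) a) l))]. *)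
Definition quote_list_body : term :=
  Lam (Lam (App (App (Var 0) (enc_term (enc_list [::])))
    (Lam (Lam (App quote_lam (App quote_lam
      (App (App quote_app (App (App quote_app (enc_term (Var 0)))
                               (quote_eta (Var 1))))
           (App (App (Var 3) (Var 3)) (Var 0))))))))).

Lemma quote_list_spec (l : seq term) :
  reduces (App (App quote_list_body quote_list_body)
               (enc_list (map enc_term l)))
          (enc_term (enc_list (map eta l))).
Proof.
elim: l => [|s l IHl]; rewrite {1}/quote_list_body.
  by do 4! beta_once; apply: reduces_refl.
rewrite [map _ _]/= [enc_list _]/=.
do 6! beta_once.
rewrite -[X in reduces _ X]/(enc_term (enc_list (map eta (s :: l)))).
do 2! apply: quote_lam_spec.
apply: quote_app_spec => //.
by apply: quote_app_spec (quote_eta_spec s); apply: reduces_refl.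
Qed.

(* The eta-expansions turn the given programs, which are closed but need not be
   values, into values. *)
Definition quoter (c : term) : term :=
  Lam (Lam (App (App quote_app (App (App quote_app (enc_term c))
                                    (quote_eta (Var 1))))
                (App (App quote_list_body quote_list_body) (Var 0)))).

Lemma quoter_spec c p l :
  reduces (App (App (quoter c) (enc_term p)) (enc_list (map enc_term l)))
          (enc_term (App (App c (eta p)) (enc_list (map eta l)))).
Proof.
rewrite /quoter; do 2! beta_once.
rewrite -[X in reduces _ X]/(enc_term (App (App c (eta p)) _)).
apply: quote_app_spec (quote_list_spec l).
by apply: quote_app_spec (quote_eta_spec p); apply: reduces_refl.
Qed.

(** * Correctness of the transformed program *)

Lemma saturate_RID_algorithm (Sigma : finType) (L : language Sigma)
    (G : monadic_system Sigma) (p : term) (P : option Sigma -> term) :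
  RID_algorithm p L -> RID_system_algorithms P G ->
  RID_algorithm
    (App (App saturate_code (eta p))
         (enc_list [seq eta (P x) | x <- enum {: option Sigma}]))
    (ancestors L G).
Proof.
case=> cp Hp HP; split.
  rewrite /closed_term /=; apply/andP; split.
    by rewrite closed_bound.
  apply: closed_bound; apply: procedure_closed; apply: procedure_enc_map => x.
  by apply: procedure_eta; case: (HP x).
move=> A; have [tr Str rtr] := saturate_code_spec A HP (procedure_eta cp).
have [b [ev Eb]] := Hp (with_trans A tr).
have vb : value (enc_bool b) by case: (b).
exists b; split; last exact: iff_trans Eb (meets_saturation L Str).
apply: reduces_eval => //; apply: reduces_trans rtr _.
apply: reduces_trans (eval_reduces vb ev).
by apply: reduces_eta => //; auto with procs.
Qed.

Theorem corollary4p2 (Sigma : finType) :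
  (forall (L : language Sigma) (G : monadic_system Sigma),
     RID L -> RID_system G -> RID (ancestors L G)) /\
  (exists T : term, closed_term T /\
     forall (L : language Sigma) (G : monadic_system Sigma)
            (p : term) (P : option Sigma -> term),
       RID_algorithm p L -> RID_system_algorithms P G ->
       exists q : term,
         eval (App (App T (enc_term p)) (enc_family P)) (enc_term q) /\
         RID_algorithm q (ancestors L G)).
Proof.
split=> [L G [p Hp] HG|].
  (* [option Sigma] is finite, so one algorithm per label can be chosen without an axiom of
     choice. *)
  have [P HP] := fin_all_exists HG.
  by eexists; apply: saturate_RID_algorithm Hp HP.
exists (quoter saturate_code); split=> [//|L G p P Hp HP].
(* The output is the quotation of an unevaluated application; no given program is run in producing
   it. *)
eexists; split; last exact: saturate_RID_algorithm Hp HP.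
apply: reduces_eval; first exact/procedure_value/procedure_enc_term.
have := quoter_spec saturate_code p [seq P x | x <- enum {: option Sigma}].
by rewrite -2!map_comp.
Qed.
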